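(* For every positive integer $n$ there exists a complete Lie algebra $\mathfrak{r}$ (finite-dimensional over $\mathbb{C}$) such that $\dim H^{2}(\mathfrak{r},\mathfrak{r})\geq n$.
   Context: A Lie algebra $\mathfrak{g}$ is called complete if $H^{0}(\mathfrak{g},\mathfrak{g})=H^{1}(\mathfrak{g},\mathfrak{g})=\{0\}$, i.e. its center is zero and every derivation is inner. Here $H^{p}(\mathfrak{g},\mathfrak{g})$ denotes the Chevalley–Eilenberg cohomology of $\mathfrak{g}$ with values in the adjoint module. *)

(* Defs.v *)
From HB Require Import structures.
From mathcomp Require Import all_boot all_order all_algebra all_fingroup.
From mathcomp Require boolp.

Set Implicit Arguments.
Unset Strict Implicit.
Unset Printing Implicit Defensive.

Import GRing.Theory.
Local Open Scope ring_scope.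

(* As a [vectType] over [K], the carrier is finite-dimensional. *)
HB.mixin Record isLieAlgebra (K : fieldType) V of Vector K V := {
  lie_bracket : V -> V -> V;
  lie_linearl : forall y : V, linear (lie_bracket^~ y);
  lie_linearr : forall x : V, linear (lie_bracket x);
  lie_alt : forall x : V, lie_bracket x x = 0;
  lie_jacobi : forall x y z : V,
    lie_bracket x (lie_bracket y z) + lie_bracket y (lie_bracket z x)
      + lie_bracket z (lie_bracket x y) = 0
}.

#[short(type="lieAlgType")]
HB.structure Definition LieAlgebra (K : fieldType) :=
  { V of isLieAlgebra K V & Vector K V }.

Notation "[ 'lie' x , y ]" := (lie_bracket x y)
  (at level 0, x at level 99, y at level 99, format "[ 'lie'  x ,  y ]")
  : ring_scope.

Section Multilinear.
Variables (K : numFieldType) (V W : vectType K).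

(* The p-linear maps V^p -> W, in curried form. *)
Fixpoint mlin (p : nat) : vectType K :=
  if p is q.+1 then 'Hom(V, mlin q) else W.

(* Only meaningful on sequences of size p; shorter ones are padded by 0. *)
Fixpoint mapply (p : nat) : mlin p -> seq V -> W :=
  match p with
  | 0 => fun w _ => w
  | q.+1 => fun f s => mapply (f (head 0 s)) (behead s)
  end.

(* The p-linear map with values [F s]; since [linfun f] agrees with [f] only
   when [f] is linear, this is the case only for multilinear [F], see
   [mcurryK]. *)
Fixpoint mcurry (p : nat) (F : seq V -> W) : mlin p :=
  match p with
  | 0 => F [::]
  | q.+1 => linfun (fun v => mcurry q (fun s => F (v :: s)))
  end.

Definition multilinear (p : nat) (F : seq V -> W) : Prop :=
  forall s1 s2 : seq V, (size s1 + size s2).+1 = p ->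
    linear (fun v => F (s1 ++ v :: s2)).

Lemma linfunE (aT rT : vectType K) (f : aT -> rT) :
  linear f -> linfun f =1 f.
Proof.
move=> lf x.
pose fL := GRing.isLinear.Build K aT rT *:%R f lf.
pose F : {linear aT -> rT} := HB.pack f fL.
exact: (lfunE F x).
Qed.

Lemma mapply_linear p s : linear (fun w : mlin p => mapply w s).
Proof.
elim: p s => [|p IH] s a u v //=.
by rewrite add_lfunE scale_lfunE IH.
Qed.

Lemma mapplyD p (u v : mlin p) s : mapply (u + v) s = mapply u s + mapply v s.
Proof. by have := mapply_linear s 1 u v; rewrite !scale1r. Qed.

Lemma mapplyZ p a (u : mlin p) s : mapply (a *: u) s = a *: mapply u s.
Proof. by elim: p u s => [|p IH] u s //=; rewrite scale_lfunE IH. Qed.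

Lemma mlin_ext p (u v : mlin p) :
  (forall s, size s = p -> mapply u s = mapply v s) -> u = v.
Proof.
elim: p u v => [|p IH] u v E; first exact: (E [::]).
apply/lfunP => x; apply: IH => s ss.
by apply: (E (x :: s)); rewrite /= ss.
Qed.

Lemma mapply_multilinear p (w : mlin p) : multilinear p (mapply w).
Proof.
elim: p w => [|p IH] w s1 s2 //= [ss] a u v.
case: s1 ss => [|x s1] /= ss.
  by rewrite linearP mapply_linear.
exact: (IH (w x) s1 s2 ss).
Qed.

Lemma mcurryK p F s :
  multilinear p F -> size s = p -> mapply (mcurry p F) s = F s.
Proof.
elim: p F s => [|p IH] F s mF; first by case: s.
case: s => [|x s] //= [ss].
have mFx v : multilinear p (fun s => F (v :: s)).
  by move=> s1 s2 s12; apply: (mF (v :: s1) s2); rewrite /= -s12.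
rewrite linfunE ?IH // => a u v; apply: mlin_ext => t tp.
rewrite mapply_linear !IH //.
by apply: (mF [::] t); rewrite /= tp.
Qed.

Lemma nths_cst (l : seq nat) (s1 s2 : seq V) v : size s1 \notin l ->
  [seq (s1 ++ v :: s2)`_k | k <- l] = [seq (s1 ++ 0 :: s2)`_k | k <- l].
Proof.
move=> nl; apply/eq_in_map => k kl; rewrite !nth_cat.
case: ltnP => // lek; have : (0 < k - size s1)%N.
  rewrite subn_gt0 ltn_neqAle lek andbT.
  by apply: contraNneq nl => ->.
by case: (k - size s1)%N.
Qed.

Lemma nths_split (l : seq nat) (s1 s2 : seq V) :
  uniq l -> size s1 \in l ->
  exists t1 t2, forall v, [seq (s1 ++ v :: s2)`_k | k <- l] = t1 ++ v :: t2.
Proof.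
move=> ul /path.splitPr H; case: H ul => l1 l2.
rewrite cat_uniq /= negb_or => /and3P[_ /andP[n1 _] /andP[n2 _]].
exists [seq (s1 ++ 0 :: s2)`_k | k <- l1], [seq (s1 ++ 0 :: s2)`_k | k <- l2].
by move=> v; rewrite map_cat /= !nths_cst // nth_cat ltnn subnn.
Qed.

Lemma nths_multilinear p q (w : mlin q) (l : seq nat) :
  uniq l -> size l = q -> {subset iota 0 p <= l} ->
  multilinear p (fun s => mapply w [seq s`_k | k <- l]).
Proof.
move=> ul sl sub s1 s2 sp.
have ml : size s1 \in l.
  by apply: sub; rewrite mem_iota /= -sp add0n ltnS leq_addr.
have [t1 [t2 E]] := nths_split s2 ul ml.
move=> a u v; rewrite !E; apply: mapply_multilinear.
by have := congr1 size (E 0); rewrite size_map size_cat /= sl addnS.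
Qed.

(* [w] with its p arguments permuted by [sg]. *)
Definition mperm p (sg : 'S_p) (w : mlin p) : mlin p :=
  mcurry p (fun s => mapply w [seq s`_(sg k) | k <- enum 'I_p]).

Lemma mpermE p (sg : 'S_p) (w : mlin p) s : size s = p ->
  mapply (mperm sg w) s = mapply w [seq s`_(sg k) | k <- enum 'I_p].
Proof.
move=> sp; rewrite mcurryK //.
have -> : (fun s => mapply w [seq s`_(sg k) | k <- enum 'I_p])
   = (fun s => mapply w [seq s`_k | k <- [seq val (sg k) | k <- enum 'I_p]]).
  by apply: boolp.funext => t; rewrite -map_comp.
apply: nths_multilinear.
- by rewrite map_inj_uniq ?enum_uniq // => x y /val_inj /perm_inj.
- by rewrite size_map size_enum_ord.
- move=> k; rewrite mem_iota /= add0n => kp.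
  apply/mapP; exists ((sg^-1)%g (Ordinal kp)); first by rewrite mem_enum.
  by rewrite permKV.
Qed.

(* The alternating p-linear maps; since [K] has characteristic 0, these are
   the skew-symmetric ones. *)
Definition altmlin p : {vspace mlin p} :=
  (\bigcap_(sg : 'S_p)
     lker (linfun (fun w : mlin p => mperm sg w - (-1) ^+ sg *: w)))%VS.

Lemma altmlinP p (w : mlin p) :
  w \in altmlin p <->
  (forall (sg : 'S_p) s, size s = p ->
     mapply w [seq s`_(sg k) | k <- enum 'I_p] = (-1) ^+ sg *: mapply w s).
Proof.
have lin sg : linear (fun w : mlin p => mperm sg w - (-1) ^+ sg *: w).
  move=> a u v; apply: mlin_ext => s sp.
  rewrite -!scaleNr !(mapplyD, mapplyZ) !mpermE // !(mapplyD, mapplyZ).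
  by rewrite !scalerDr !scalerA [a * _]mulrC addrACA.
split=> [wA sg s sp | H].
  have := subv_bigcapP wA sg isT; rewrite -memvE memv_ker linfunE //.
  by rewrite subr_eq0 => /eqP E; rewrite -mpermE // E mapplyZ.
rewrite memvE; apply/subv_bigcapP => sg _; rewrite -memvE memv_ker linfunE //.
rewrite subr_eq0; apply/eqP/mlin_ext => s sp.
by rewrite mpermE // H // mapplyZ.
Qed.

End Multilinear.

Section Cohomology.
Variables (K : numFieldType) (g : lieAlgType K).

Implicit Type s : seq g.

(* For s = (x_0, ..., x_p):
   \sum_i (-1)^i [x_i, w(.., ^x_i, ..)]
   + \sum_(i < j) (-1)^(i + j) w([x_i, x_j], .., ^x_i, .., ^x_j, ..),
   where ^ marks an omitted argument. *)
Definition ce_formula p (w : mlin g g p) s : g :=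
  \sum_(i < p.+1) (-1) ^+ i *:
    [lie s`_i, mapply w [seq s`_k | k <- iota 0 p.+1 & k != i :> nat]]
  + \sum_(i < p.+1) \sum_(j < p.+1 | (i < j)%N) (-1) ^+ (i + j) *:
      mapply w ([lie s`_i, s`_j] ::
        [seq s`_k | k <- iota 0 p.+1 & (k != i :> nat) && (k != j :> nat)]).

Definition ce_d p : 'Hom(mlin g g p, mlin g g p.+1) :=
  linfun (fun w => mcurry p.+1 (ce_formula w)).

Lemma nth_mid (s1 s2 : seq g) v : (s1 ++ v :: s2)`_(size s1) = v.
Proof. by rewrite nth_cat ltnn subnn. Qed.

Lemma nth_cst (s1 s2 : seq g) k v : k != size s1 ->
  (s1 ++ v :: s2)`_k = (s1 ++ 0 :: s2)`_k.
Proof.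
move=> nk; have := @nths_cst K g [:: k] s1 s2 v.
by rewrite inE eq_sym => /(_ nk) [].
Qed.

Lemma mapply_nths_linear p (w : mlin g g p) (l : seq nat) (t0 s1 s2 : seq g) :
  uniq l -> size s1 \in l -> (size t0 + size l)%N = p ->
  linear (fun v => mapply w (t0 ++ [seq (s1 ++ v :: s2)`_k | k <- l])).
Proof.
move=> ul ml sl a u v.
have [t1 [t2 E]] := nths_split s2 ul ml.
rewrite !E !catA; apply: mapply_multilinear; rewrite -sl size_cat.
have := congr1 size (E 0); rewrite size_map size_cat /= => ->.
by rewrite !addnS addnA.
Qed.

Lemma size_filter1 p i : (i < p.+1)%N ->
  size [seq k <- iota 0 p.+1 | k != i] = p.
Proof.
move=> ip; have ii : i \in iota 0 p.+1 by rewrite mem_iota.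
have := size_rem ii; rewrite rem_filter ?iota_uniq // size_iota.
by move=> E; rewrite -[RHS]/(p.+1.-1) -E.
Qed.

Lemma size_filter2 p i j : (i < p.+1)%N -> (j < p.+1)%N -> i != j ->
  (size [seq k <- iota 0 p.+1 | (k != i) && (k != j)]).+1 = p.
Proof.
move=> ip jp ij; set l := [seq k <- iota 0 p.+1 | k != j].
have ul : uniq l by rewrite filter_uniq ?iota_uniq.
have il : i \in l by rewrite mem_filter ij mem_iota.
have := size_rem il; rewrite rem_filter // -filter_predI size_filter1 // => E.
have pp : (0 < p)%N.
  rewrite lt0n; apply: contraNneq ij => p0; move: ip jp.
  by rewrite p0 !ltnS !leqn0 => /eqP-> /eqP->.
by rewrite -[RHS](prednK pp); congr _.+1; exact: E.
Qed.

Lemma ce_formula_multilinear p (w : mlin g g p) :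
  multilinear p.+1 (ce_formula w).
Proof.
move=> s1 s2 s12; set F := fun v => _.
have mp : (size s1 < p.+1)%N by rewrite -s12 ltnS leq_addr.
have linD (f1 f2 : g -> g) : linear f1 -> linear f2 ->
    linear (fun v => f1 v + f2 v).
  by move=> l1 l2 a u v; rewrite l1 l2 scalerDr addrACA.
have lin_sum n (P : pred 'I_n) (f : 'I_n -> g -> g) :
    (forall i, P i -> linear (f i)) -> linear (fun v => \sum_(i | P i) f i v).
  move=> lf a u v; rewrite scaler_sumr -big_split /=.
  by apply: eq_bigr => i Pi; rewrite lf.
have linZ c (f : g -> g) : linear f -> linear (fun v => c *: f v).
  by move=> lf a u v; rewrite lf scalerDr !scalerA mulrC.
have iotaP k : (k \in iota 0 p.+1) = (k < p.+1)%N by rewrite mem_iota.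
have uF (P : pred nat) : uniq (filter P (iota 0 p.+1)).
  by rewrite filter_uniq ?iota_uniq.
apply: linD.
  apply: (@lin_sum _ predT) => i _; apply: linZ.
  have [im|nim] := eqVneq (i : nat) (size s1).
    move=> a u v; rewrite {1 3 5}im !nth_mid.
    have nl : size s1 \notin [seq k <- iota 0 p.+1 | k != i :> nat].
      by rewrite mem_filter im eqxx.
    by rewrite 2!(nths_cst _ _ nl) -(nths_cst s2 v nl) lie_linearl.
  move=> a u v; rewrite 3!(nth_cst _ _ nim) -lie_linearr; congr lie_bracket.
  apply: (@mapply_nths_linear _ _ _ [::]) => //.
    by rewrite mem_filter iotaP mp eq_sym nim.
  by rewrite add0n size_filter1.
apply: (@lin_sum _ predT) => i _.
apply: lin_sum => j ij; apply: linZ.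
have nij : (i : nat) != j by rewrite neq_ltn ij.
have szl := size_filter2 (ltn_ord i) (ltn_ord j) nij.
have [nl | ml] := boolP (size s1 \notin
    [seq k <- iota 0 p.+1 | (k != i :> nat) && (k != j :> nat)]).
  have bl : linear (fun v => [lie (s1 ++ v :: s2)`_i, (s1 ++ v :: s2)`_j]).
    move: nl; rewrite mem_filter iotaP mp andbT negb_and !negbK.
    have [im _|nim /= /eqP jm] := eqVneq (size s1) i.
      have nj : (j : nat) != size s1 by rewrite im eq_sym.
      move=> a u v; rewrite !(nth_cst _ _ nj) -im !nth_mid.
      exact: lie_linearl.
    rewrite eq_sym in nim.
    move=> a u v; rewrite !(nth_cst _ _ nim) -jm !nth_mid.
    exact: lie_linearr.
  move=> a u v; rewrite !(nths_cst _ _ nl) bl.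
  by apply: (mapply_multilinear w (s1 := [::])); rewrite size_map.
rewrite negbK in ml.
have : (size s1 != i) && (size s1 != j).
  by move: ml; rewrite mem_filter => /andP[].
rewrite ![size s1 == _]eq_sym => /andP[nim njm].
move=> a u v; rewrite !(nth_cst _ _ nim) !(nth_cst _ _ njm).
by apply: (@mapply_nths_linear _ _ _ [:: _]); rewrite ?szl.
Qed.

Lemma ce_dE p (w : mlin g g p) s :
  size s = p.+1 -> mapply (ce_d p w) s = ce_formula w s.
Proof.
move=> sp; rewrite linfunE ?mcurryK //; first exact: ce_formula_multilinear.
move=> a u v; apply: mlin_ext => t tp.
have mF x := @ce_formula_multilinear p x.
rewrite mapply_linear !mcurryK // /ce_formula scalerDr addrACA.
congr (_ + _); rewrite scaler_sumr -big_split /=; apply: eq_bigr => i _.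
  by rewrite mapply_linear lie_linearr scalerDr !scalerA mulrC.
rewrite scaler_sumr -big_split /=; apply: eq_bigr => j _.
by rewrite mapply_linear scalerDr !scalerA mulrC.
Qed.

Definition cochain p : {vspace mlin g g p} := altmlin g g p.

Definition cocycle p : {vspace mlin g g p} := (cochain p :&: lker (ce_d p))%VS.

Definition coboundary p : {vspace mlin g g p} :=
  match p with
  | 0 => 0%VS
  | q.+1 => (ce_d q @: cochain q)%VS
  end.

(* H^p(g, g), the quotient of the cocycles by the coboundaries, is realized as
   a complement in the cocycles of the subspace of coboundaries; see
   [coboundary_cocycle] for the inclusion of the latter in the former. *)
Definition cohomology p : {vspace mlin g g p} :=
  (cocycle p :\: coboundary p)%VS.

Definition lie_complete : Prop := cohomology 0 = 0%VS /\ cohomology 1 = 0%VS.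

End Cohomology.

(* Cancels opposite terms in a sum to be shown equal to 0. *)
Ltac zmod_cancel :=
  rewrite -[LHS]add0r ?(opprD, opprK, addrA);
  repeat match goal with
  | |- _ - ?z = _ => rewrite ?(addrAC _ z) addrNK
  | |- _ + ?z = _ => rewrite ?(addrAC _ (- z)) addrK
  end.

Section LowDegree.
Variables (K : numFieldType) (g : lieAlgType K).

Lemma lieC (x y : g) : [lie x, y] = - [lie y, x].
Proof.
have D1 (a b c : g) : [lie a + b, c] = [lie a, c] + [lie b, c].
  by have := lie_linearl c 1 a b; rewrite !scale1r.
have D2 (a b c : g) : [lie c, a + b] = [lie c, a] + [lie c, b].
  by have := lie_linearr c 1 a b; rewrite !scale1r.
have := lie_alt (x + y); rewrite D1 !D2 !lie_alt add0r addr0.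
by move/eqP; rewrite addr_eq0 => /eqP.
Qed.

Lemma ce_d0E (w : mlin g g 0) x : mapply (ce_d g 0 w) [:: x] = [lie x, w].
Proof.
rewrite ce_dE // /ce_formula !big_ord_recl !big_ord0 /= expr0 scale1r !addr0.
by rewrite big_pred0 ?addr0 // => i; case: i => -[].
Qed.

Lemma ce_d1E (f : mlin g g 1) x y :
   mapply (ce_d g 1 f) [:: x; y] =
   [lie x, f y] - [lie y, f x] - f [lie x, y].
Proof.
rewrite ce_dE // /ce_formula.
under [X in _ + X]eq_bigr => i _ do rewrite big_mkcond.
rewrite !big_ord_recl !big_ord0 /= .
by rewrite !(expr0, expr1, scale1r, scaleN1r, addr0, add0r).
Qed.

Lemma ce_d2E (w : mlin g g 2) x y z :
   mapply (ce_d g 2 w) [:: x; y; z] =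
   [lie x, w y z] - [lie y, w x z] + [lie z, w x y]
    - w [lie x, y] z + w [lie x, z] y - w [lie y, z] x.
Proof.
rewrite ce_dE // /ce_formula.
under [X in _ + X]eq_bigr => i _ do rewrite big_mkcond.
rewrite !big_ord_recl !big_ord0 /= .
rewrite /bump /= !(expr0, expr1, scale1r, scaleN1r, addr0, add0r).
rewrite !exprD !expr1 ?sqrrN ?expr1n !mulN1r ?mul1r ?opprK ?mulr1.
rewrite ?scale1r ?scaleN1r.
by rewrite ?addrA.
Qed.

Lemma cochain0 (w : mlin g g 0) : w \in cochain g 0.
Proof.
apply/altmlinP => sg s /size0nil ->.
have -> : sg = 1%g by apply/permP => -[].
by rewrite odd_perm1 expr0 scale1r.
Qed.

Lemma cochain1 (w : mlin g g 1) : w \in cochain g 1.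
Proof.
apply/altmlinP => sg s s1.
have -> : sg = 1%g by apply/permP => x; rewrite !ord1.
rewrite odd_perm1 expr0 scale1r; congr mapply; case: s s1 => [|x []] //= _.
by rewrite enum_ordSl enum_ord0 /= perm1.
Qed.

Lemma cochain2 (w : mlin g g 2) :
  (w \in cochain g 2) <-> (forall x y, w x y = - w y x).
Proof.
split=> [/altmlinP H x y|H].
  have := H (tperm ord0 ord_max) [:: y; x] erefl.
  rewrite odd_tperm /= expr1 scaleN1r /= => <-.
  rewrite !enum_ordSl enum_ord0 /=.
  have -> : lift ord0 ord0 = ord_max :> 'I_2 by apply: val_inj.
  by rewrite tpermL tpermR.
apply/altmlinP => sg [|x [|y []]] // _.
rewrite !enum_ordSl enum_ord0 /=.
have [e|n] := eqVneq (sg ord0) ord0.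
  have -> : sg = 1%g.
    apply/permP => i; rewrite perm1; have : i = ord0 \/ i = ord_max.
      by case: i => -[|[]] // ?; [left|right]; apply: val_inj.
    case=> -> //; have : sg ord_max != ord0 by rewrite -e (inj_eq perm_inj).
    by case: (sg ord_max) => -[|[]] // ?; move=> _; apply: val_inj.
  by rewrite odd_perm1 expr0 scale1r !perm1.
have -> : sg = tperm ord0 ord_max.
  have e : sg ord0 = ord_max.
    by case: (sg ord0) n => -[|[]] // ? _; apply: val_inj.
  have e2 : sg ord_max = ord0.
    have : sg ord_max != ord_max by rewrite -e (inj_eq perm_inj).
    by case: (sg ord_max) => -[|[]] // ?; move=> _; apply: val_inj.
  apply/permP => i;  have : i = ord0 \/ i = ord_max.
      by case: i => -[|[]] // ?; [left|right]; apply: val_inj.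
  by case=> ->; rewrite ?tpermL ?tpermR.
have -> : lift ord0 ord0 = ord_max :> 'I_2 by apply: val_inj.
by rewrite tpermL tpermR odd_tperm /= expr1 scaleN1r H.
Qed.

Lemma lieDl (a b c : g) : [lie a + b, c] = [lie a, c] + [lie b, c].
Proof. by have := lie_linearl c 1 a b; rewrite !scale1r. Qed.
Lemma lieDr (a b c : g) : [lie c, a + b] = [lie c, a] + [lie c, b].
Proof. by have := lie_linearr c 1 a b; rewrite !scale1r. Qed.
Lemma lie0r (c : g) : [lie c, 0] = 0.
Proof.
by have := lie_linearr c (-1) 0 0; rewrite !scaleN1r oppr0 addr0 addNr.
Qed.
Lemma lieNr (a c : g) : [lie c, - a] = - [lie c, a].
Proof. by have := lie_linearr c (-1) a 0; rewrite !scaleN1r lie0r !addr0. Qed.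
Lemma lieNl (a c : g) : [lie - a, c] = - [lie a, c].
Proof. by rewrite lieC lieNr opprK lieC. Qed.
Lemma lie_jac (x y z : g) :
  [lie x, [lie y, z]] = [lie [lie x, y], z] + [lie y, [lie x, z]].
Proof.
have /eqP := lie_jacobi x y z.
rewrite (lieC z x) lieNr (lieC z) -addrA addr_eq0 => /eqP ->.
by rewrite opprD !opprK addrC.
Qed.

Lemma coboundary_cocycle p : (p <= 2)%N -> (coboundary g p <= cocycle g p)%VS.
Proof.
case: p => [|[|[|]]] // _; first by rewrite sub0v.
- apply/subvP => _ /memv_imgP[w _ ->].
  rewrite memv_cap cochain1 memv_ker; apply/eqP/mlin_ext => -[|x [|y []]] // _.
  rewrite ce_d1E; set dw := ce_d g 0 w.
  have E u : (dw : mlin g g 1) u = [lie u, w] by have := ce_d0E w u.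
  rewrite !E lie_jac addrK subrr; by rewrite /= !lfunE.
- apply/subvP => _ /memv_imgP[f _ ->].
  have E u v : ce_d g 1 f u v = [lie u, f v] - [lie v, f u] - f [lie u, v]
    by have := ce_d1E f u v.
  rewrite memv_cap memv_ker; apply/andP; split.
    apply/cochain2 => x y; rewrite !E (lieC y x) linearN !opprD !opprK.
    by rewrite [- _ + _]addrC.
  apply/eqP/mlin_ext => -[|x [|y [|z []]]] // _.
  rewrite ce_d2E !E; rewrite !(lieDr, lieNr).
  rewrite (lie_jac x y) (lie_jac x z) (lie_jac y z).
  have -> : f [lie [lie x, y], z] =
      f [lie x, [lie y, z]] - f [lie y, [lie x, z]].
    by rewrite (lie_jac x y z) linearD /= addrK.
  rewrite (lieC _ y) (lieC _ z) (lieC _ x) !linearN /=.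
  rewrite !(lieNl, lieNr, opprK) ?linearN /= .
  have E1 : f [lie [lie z, x], y] = - f [lie y, [lie z, x]].
    by rewrite lieC linearN.
  have E2 : f [lie [lie y, z], x] = - f [lie x, [lie y, z]].
    by rewrite lieC linearN.
  (* Syntactic abstraction; matching modulo conversion is too slow here. *)
  move: E1 E2; generalize (f [lie [lie z, x], y]) (f [lie [lie y, z], x]).
  move=> _ _ -> ->.
  rewrite [RHS](_ : _ = 0) /=; last by rewrite !lfunE.
  by zmod_cancel.
Qed.

(* The center is zero and every derivation is inner. *)
Lemma lie_completeP : lie_complete g <->
  (forall z : g, (forall x, [lie x, z] = 0) -> z = 0) /\
  (forall D : g -> g, linear D ->
     (forall x y, D [lie x, y] = [lie D x, y] + [lie x, D y]) ->
     exists z, forall x, D x = [lie z, x]).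
Proof.
have dl := @linfunE.
split=> [[/eqP H0 /eqP H1]|[H0 H1]].
  move: H0 H1; rewrite !diffv_eq0 => /subvP H0 /subvP H1; split.
    move=> z zc; have := H0 z; rewrite memv0 => H; apply/eqP/H.
    rewrite memv_cap cochain0 memv_ker; apply/eqP/mlin_ext => -[|x []] // _.
    by rewrite ce_d0E zc /= lfunE.
  move=> D lD dD; have := H1 (linfun D).
  rewrite memv_cap cochain1 memv_ker => H.
  have /memv_imgP[z _ E]: (linfun D : mlin g g 1) \in coboundary g 1.
    apply: H; apply/eqP/mlin_ext => -[|x [|y []]] // _.
    rewrite ce_d1E !dl // dD (lieC _ y).
    rewrite [RHS](_ : _ = 0) /=; last by rewrite !lfunE.
    by zmod_cancel.
  exists (- z) => x; rewrite lieNl -lieC -(ce_d0E z) -E /= dl //.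
split; apply/eqP; rewrite diffv_eq0; apply/subvP => f.
all: rewrite memv_cap => /andP[_].
  rewrite memv_ker => /eqP E; rewrite memv0; apply/eqP/H0 => x.
  by rewrite -(ce_d0E f) E /= lfunE.
rewrite memv_ker => /eqP E.
have [x y|z Ez] := H1 f (linearP f).
  have := ce_d1E f x y; rewrite E /= !lfunE => /esym/eqP.
  rewrite subr_eq0 => /eqP <-.
  by rewrite addrC (lieC y) opprK.
apply/memv_imgP; exists (- z); first exact: cochain0.
apply: mlin_ext => -[|x []] // _; by rewrite ce_d0E lieNr -lieC -Ez.
Qed.

End LowDegree.

(* Main.v *)
(** The truncated Witt algebra [W_d], with basis [e_0, .., e_(d-1)] and
    [[e_i, e_j] = (j - i) e_(i+j)], is complete for [d >= 6]: up to an inner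
    derivation, a derivation kills [e_0], so it preserves the one-dimensional
    weight spaces of [ad e_0] and multiplies [e_i] by some [p_i] with
    [p_(i+j) = p_i + p_j] for [i <> j]; hence [p_i = i p_1] and it is
    [p_1 ad e_0].  For [d = 8], a 2-cochain of weight 0 that vanishes on all
    pairs [(e_i, e_j)], [i < j], but [(e_2, e_5)] and [(e_3, e_4)], if it is
    the coboundary of [f], forces the same relations on the diagonal of [f],
    except the ones giving [p_7] as [p_2 + p_5] or [p_3 + p_4]; these then
    follow, so a nonzero cocycle of this form is not a coboundary.
    The n-th direct power of a complete algebra is complete, and the
    copies of a nontrivial class on the n factors are independent. *)

From HB Require Import structures.
Require Import Defs.
From mathcomp Require Import all_boot all_order all_algebra.
From mathcomp Require Import reals complex ring.
Set Implicit Arguments.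
Unset Strict Implicit.
Unset Printing Implicit Defensive.

Import GRing.Theory Num.Theory.
Local Open Scope ring_scope.

(** * The Euler operator and the commutator of vector fields on polynomials *)

Definition euler (K : fieldType) (p : {poly K}) : {poly K} := 'X * p^`().

Lemma euler_is_linear (K : fieldType) : linear (@euler K).
Proof. by move=> a p q; rewrite /euler linearP mulrDr -scalerAr. Qed.
HB.instance Definition _ (K : fieldType) :=
  GRing.isLinear.Build K {poly K} {poly K} *:%R (@euler K)
    (@euler_is_linear K).

Lemma eulerM (K : fieldType) (p q : {poly K}) :
  euler (p * q) = euler p * q + p * euler q.
Proof. by rewrite /euler derivM; ring. Qed.

Lemma coef_euler (K : fieldType) (p : {poly K}) k :
  (euler p)`_k = k%:R * p`_k.
Proof.
rewrite /euler coefXM; case: k => [|k]; rewrite ?mul0r //.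
by rewrite coef_deriv mulr_natl.
Qed.

(** The commutator of [p X d/dX] and [q X d/dX] is this polynomial times [X d/dX]; on [X^i] and
    [X^j] it is [(j - i) X^(i+j)]. *)
Definition wronskian (K : fieldType) (p q : {poly K}) : {poly K} :=
  p * euler q - euler p * q.

Lemma wronskian_linearr (K : fieldType) (p : {poly K}) : linear (wronskian p).
Proof.
move=> a q r; rewrite /wronskian linearP !mulrDr -!scalerAr.
by rewrite -!mul_polyC; ring.
Qed.

Lemma wronskianC (K : fieldType) (p q : {poly K}) :
  wronskian p q = - wronskian q p.
Proof. by rewrite /wronskian; ring. Qed.

Lemma wronskian_jacobi (K : fieldType) (p q r : {poly K}) :
  wronskian p (wronskian q r) + wronskian q (wronskian r p)
    + wronskian r (wronskian p q) = 0.
Proof. by rewrite /wronskian !linearB /= !eulerM; ring. Qed.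

Lemma coef_wronskian (K : fieldType) (p q : {poly K}) k :
  (wronskian p q)`_k =
  \sum_(i < k.+1) (((k - i)%:R - i%:R) * (p`_i * q`_(k - i))).
Proof.
rewrite /wronskian coefB !coefM -sumrB; apply: eq_bigr => i _.
by rewrite !coef_euler; ring.
Qed.

(* A vector [x] stands for the vector field [p(X) X d/dX] modulo [X^d], where
   [p = rVpoly x]; the Lie bracket of two such is given by [wronskian]. *)
Definition witt (K : fieldType) (d : nat) := 'rV[K]_d.

(** * The Lie algebra structure of the truncated Witt algebra *)

Section Witt.
Variables (K : fieldType) (d : nat).

HB.instance Definition _ := Vector.copy (witt K d) 'rV[K]_d.

Implicit Types x y z : witt K d.

Definition witt_bracket x y : witt K d :=
  poly_rV (wronskian (rVpoly x) (rVpoly y)).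

(** Coefficient [k] of a wronskian involves only coefficients of index at most [k], so truncation
    respects it; the Jacobi identity then descends from polynomials. *)
Lemma poly_rV_wronskian (p q : {poly K}) :
  poly_rV (wronskian p (rVpoly (poly_rV q : 'rV_d))) =
  poly_rV (wronskian p q) :> 'rV_d.
Proof.
apply/rowP => k; rewrite !mxE !coef_wronskian; apply: eq_bigr => i _.
have kid : (k - i < d)%N by exact: leq_ltn_trans (leq_subr _ _) (ltn_ord k).
by rewrite coef_rVpoly insubT mxE.
Qed.

Lemma witt_linearr x : linear (witt_bracket x).
Proof.
by move=> a y z; rewrite /witt_bracket linearP /= wronskian_linearr linearP.
Qed.

Lemma witt_bracketC x y : witt_bracket x y = - witt_bracket y x.
Proof. by rewrite /witt_bracket wronskianC linearN. Qed.

Lemma witt_linearl y : linear (witt_bracket^~ y).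
Proof.
by move=> a x z; rewrite /= !(witt_bracketC _ y) witt_linearr opprD scalerN.
Qed.

Lemma witt_alt x : witt_bracket x x = 0.
Proof. by rewrite /witt_bracket /wronskian mulrC subrr linear0. Qed.

Lemma witt_jacobi x y z :
  witt_bracket x (witt_bracket y z) + witt_bracket y (witt_bracket z x)
    + witt_bracket z (witt_bracket x y) = 0.
Proof.
rewrite /witt_bracket !poly_rV_wronskian -!linearD /=.
by rewrite wronskian_jacobi linear0.
Qed.

HB.instance Definition _ :=
  isLieAlgebra.Build K (witt K d) witt_linearl witt_linearr witt_alt witt_jacobi.

End Witt.

Lemma lieZr (K : numFieldType) (g : lieAlgType K) a (x y : g) :
  [lie x, a *: y] = a *: [lie x, y].
Proof. by have := lie_linearr x a y 0; rewrite lie0r !addr0. Qed.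

Lemma lieZl (K : numFieldType) (g : lieAlgType K) a (x y : g) :
  [lie a *: x, y] = a *: [lie x, y].
Proof. by rewrite lieC lieZr -scalerN -lieC. Qed.

(** * Coordinates, center and derivations of the Witt algebra *)

Section WittComplete.
Variables (K : numFieldType) (d : nat).
Implicit Types x y z : witt K d.

(** Coordinates and basis vectors are indexed by [nat], with value 0 from [d] on, so that sums and
    differences of indices need no casts. *)
Definition witt_coef x k : K := (rVpoly x)`_k.
Definition witt_vec k : witt K d := poly_rV 'X^k.

Lemma witt_coefD x y k : witt_coef (x + y) k = witt_coef x k + witt_coef y k.
Proof. by rewrite /witt_coef linearD coefD. Qed.

Lemma witt_coefZ a x k : witt_coef (a *: x) k = a * witt_coef x k.
Proof. by rewrite /witt_coef linearZ coefZ. Qed.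

Lemma witt_coef_eq x y :
  (forall k, (k < d)%N -> witt_coef x k = witt_coef y k) -> x = y.
Proof.
move=> E; apply/rowP => k; have := E _ (ltn_ord k).
by rewrite /witt_coef !coef_rVpoly_ord.
Qed.

Lemma witt_coef_row (p : nat -> K) k : (k < d)%N ->
  witt_coef (\row_(i < d) p i : witt K d) k = p k.
Proof. by move=> kd; rewrite /witt_coef coef_rVpoly insubT mxE. Qed.

Lemma witt_coef_vec i k : (k < d)%N -> witt_coef (witt_vec i) k = (k == i)%:R.
Proof. by move=> kd; rewrite /witt_coef coef_rVpoly insubT mxE coefXn. Qed.

Lemma witt_coef_lie x y k : (k < d)%N ->
  witt_coef [lie x, y] k =
  \sum_(i < k.+1)
     (((k - i)%:R - i%:R) * (witt_coef x i * witt_coef y (k - i))).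
Proof.
move=> kd; rewrite /witt_coef coef_rVpoly insubT mxE /=.
exact: coef_wronskian.
Qed.

Lemma witt_coef_lie_vec i y k : (i <= k < d)%N ->
  witt_coef [lie witt_vec i, y] k =
  ((k - i)%:R - i%:R) * witt_coef y (k - i).
Proof.
case/andP=> ik kd; rewrite witt_coef_lie // (bigD1 (Ordinal (n:=k.+1) ik)) //=.
rewrite witt_coef_vec ?(leq_ltn_trans ik) // eqxx mul1r big1 ?addr0 // => j ji.
rewrite witt_coef_vec; last by apply: leq_trans kd; apply: ltn_ord.
by move: ji; rewrite -val_eqE /= => /negbTE->; rewrite mul0r mulr0.
Qed.

Lemma witt_coef_lie_vec0 y k : (k < d)%N ->
  witt_coef [lie witt_vec 0, y] k = k%:R * witt_coef y k.
Proof. by move=> kd; rewrite witt_coef_lie_vec // subn0 subr0. Qed.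

Lemma lie_witt_vec i j : (i + j < d)%N ->
  [lie witt_vec i, witt_vec j] = (j%:R - i%:R) *: witt_vec (i + j).
Proof.
move=> ijd; apply: witt_coef_eq => k kd; rewrite witt_coefZ witt_coef_vec //.
have [ik|ki] := leqP i k.
  rewrite witt_coef_lie_vec ?ik //.
  rewrite witt_coef_vec ?(leq_ltn_trans (leq_subr _ _)) //.
  rewrite -(eqn_add2l i) subnKC //; case: eqP => [->|_]; last by rewrite !mulr0.
  by rewrite addKn.
rewrite witt_coef_lie // big1 => [|l _].
  by rewrite ltn_eqF ?mulr0 // (leq_trans ki) ?leq_addr.
have lk : (l <= k)%N by rewrite -ltnS.
rewrite witt_coef_vec ?(leq_ltn_trans lk) //.
by rewrite (ltn_eqF (leq_ltn_trans lk ki)) mul0r mulr0.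
Qed.

Lemma witt_vec_sum x : x = \sum_(i < d) witt_coef x i *: witt_vec i.
Proof.
apply: witt_coef_eq => k kd; rewrite {2}/witt_coef linear_sum coef_sum /=.
rewrite (bigD1 (Ordinal kd)) //= big1 ?addr0 => [|i ik].
  by rewrite linearZ coefZ /= -/(witt_coef _ _) witt_coef_vec // eqxx mulr1.
rewrite linearZ coefZ /= -/(witt_coef (witt_vec i) k) witt_coef_vec //.
by move: ik; rewrite -val_eqE /= eq_sym => /negbTE->; rewrite mulr0.
Qed.

Lemma eq_witt_linear (D E : witt K d -> witt K d) : linear D -> linear E ->
  (forall i, (i < d)%N -> D (witt_vec i) = E (witt_vec i)) -> D =1 E.
Proof.
move=> lD lE DE x; rewrite -(linfunE lD) -(linfunE lE) (witt_vec_sum x).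
by rewrite !linear_sum; apply: eq_bigr => i _; rewrite !linearZ /= !linfunE ?DE.
Qed.

(** Bracketing with [e_0] multiplies coordinate [k] by [k], which leaves only coordinate 0;
    bracketing with [e_1] detects that one. *)
Lemma witt_center x : (1 < d)%N -> (forall y, [lie y, x] = 0) -> x = 0.
Proof.
move=> d1 xc; have c0 k : witt_coef 0 k = 0 by rewrite /witt_coef linear0 coef0.
apply: witt_coef_eq => -[|k] kd; rewrite c0.
  have := witt_coef_lie_vec (i:=1) x (k:=1).
  rewrite xc c0 d1 => /(_ isT)/esym/eqP.
  by rewrite subnn sub0r mulN1r oppr_eq0 => /eqP.
have := witt_coef_lie_vec0 x kd; rewrite xc c0 => /esym/eqP.
by rewrite mulf_eq0 pnatr_eq0 => /eqP.
Qed.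

(** Comparing [p 5 = p 1 + p 4 = p 1 + p 1 + p 3] with [p 5 = p 2 + p 3] gives [p 2], on which
    [[e_1, e_1] = 0] yields no relation; induction does the rest. Only the pairs [(1, j)] and
    [(2, 3)] enter, so the lemma serves both derivations and the cocycle on [W_8]. *)
Lemma weights_proportional (p : nat -> K) : (5 < d)%N ->
  (forall j, (1 < j)%N -> (j.+1 < d)%N -> p j.+1 = p 1%N + p j) ->
  p 5 = p 2 + p 3 -> forall i, (0 < i < d)%N -> p i = i%:R * p 1%N.
Proof.
move=> d5 pS p5.
have p2 : p 2 = p 1%N + p 1%N.
  apply: (addIr (p 3)); rewrite -p5 (pS 4) // (pS 3) ?(ltnW d5) //.
  by rewrite addrA.
elim=> [//|[|[|i]] IH] /andP[_ id]; [by rewrite mul1r|by rewrite p2; ring|].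
by rewrite pS // IH ?(ltnW id) // [in RHS]mulrS; ring.
Qed.

Theorem witt_complete : (5 < d)%N -> lie_complete (witt K d).
Proof.
move=> d5; have d0 : (0 < d)%N by apply: leq_trans d5.
have d1 : (1 < d)%N by apply: leq_trans d5.
apply/lie_completeP; split=> [z zc|D lD dD]; first exact: witt_center.
pose h := witt_vec 0.
(* Coefficient 1 of [D] applied to [[e_0, e_1] = e_1]. *)
have Dh0 : witt_coef (D h) 0 = 0.
  have := congr1 (witt_coef^~ 1%N) (dD h (witt_vec 1)).
  rewrite /= lie_witt_vec // subr0 scale1r addnC witt_coefD.
  rewrite witt_coef_lie_vec0 //.
  rewrite mul1r => /esym/eqP; rewrite -subr_eq0 addrK lieC -scaleN1r witt_coefZ.
  rewrite witt_coef_lie_vec // subnn sub0r !mulN1r opprK => /eqP //.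
(* Solves [[z, h] = D h], that is [- k z_k = (D h)_k]; at [k = 0] the convention [0^-1 = 0] gives
   [z_0 = 0], consistent with [Dh0]. *)
pose z : witt K d := \row_(k < d) (- k%:R^-1 * witt_coef (D h) k).
pose D' x := D x - [lie z, x].
have lD' : linear D'.
  move=> a x y; rewrite /D' lD lie_linearr opprD addrACA -scalerN -scalerDr //.
have D'E x : D x = D' x + [lie z, x] by rewrite subrK.
have dD' x y : D' [lie x, y] = [lie D' x, y] + [lie x, D' y].
  rewrite /D' dD lie_jac !(lieDl, lieDr, lieNl, lieNr) opprD addrACA //.
have D'h : D' h = 0.
  apply: (addIr [lie z, h]); rewrite -D'E add0r lieC.
  apply: witt_coef_eq => k kd.
  rewrite -scaleN1r witt_coefZ witt_coef_lie_vec0 //.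
  rewrite (witt_coef_row (fun k => - k%:R^-1 * witt_coef (D h) k)) //.
  have [->|k0] := eqVneq k 0%N; first by rewrite Dh0; ring.
  by field; rewrite pnatr_eq0.
have D'Z a x : D' (a *: x) = a *: D' x.
  have D'0 : D' 0 = 0.
    by have := lD' (-1) 0 0; rewrite scaler0 addr0 scaleN1r addNr.
  by have := lD' a x 0; rewrite D'0 !addr0.
pose p i := witt_coef (D' (witt_vec i)) i.
(* [D'] kills [h], hence commutes with [ad h], whose eigenvalues [0, .., d-1] are distinct. *)
have D'p i : (i < d)%N -> D' (witt_vec i) = p i *: witt_vec i.
  move=> id; apply: witt_coef_eq => k kd; rewrite witt_coefZ witt_coef_vec //.
  have [->|ki] := eqVneq k i; first by rewrite mulr1.
  have := congr1 (witt_coef^~ k) (dD' h (witt_vec i)).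
  rewrite /= D'h (lieC 0) lie0r oppr0 add0r witt_coef_lie_vec0 //.
  rewrite lie_witt_vec //.
  rewrite subr0 add0n D'Z witt_coefZ => /eqP.
  rewrite -subr_eq0 -mulrBl mulf_eq0 subr_eq0 eqr_nat eq_sym (negbTE ki) /=.
  by move/eqP->; rewrite mulr0.
have pD i j : (i < j)%N -> (i + j < d)%N -> p (i + j)%N = p i + p j.
  move=> ij ijd; have id : (i < d)%N.
    by apply: leq_ltn_trans ijd; apply: leq_addr.
  have jd : (j < d)%N by apply: leq_ltn_trans ijd; apply: leq_addl.
  have := dD' (witt_vec i) (witt_vec j).
  rewrite (D'p _ id) (D'p _ jd) lieZl lieZr lie_witt_vec //.
  rewrite D'Z (D'p _ ijd).
  rewrite -scalerDl !scalerA => /(congr1 (witt_coef^~ (i + j)%N)) /=.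
  rewrite !witt_coefZ witt_coef_vec // eqxx !mulr1 [RHS]mulrC => /mulfI -> //.
  by rewrite subr_eq0 eqr_nat gtn_eqF.
have pE := @weights_proportional p d5 (fun j => @pD 1 j) (@pD 2 3 isT d5).
exists (z + p 1%N *: h); apply: eq_witt_linear => //; first exact: lie_linearr.
move=> i id; rewrite D'E D'p // lieDl lieZl lie_witt_vec // subr0 addrC.
(* For [i = 0], outside the range of [pE], both sides vanish because [D' h = 0]. *)
rewrite scalerA; case: i id => [|i] id; last by rewrite pE // mulrC.
by rewrite mulr0 /p D'h /witt_coef linear0 coef0.
Qed.
End WittComplete.

(** * Bilinear maps as cochains; criteria for 2-cocycles and 2-coboundaries *)

Lemma bilinear_mlin (K : numFieldType) (V W : vectType K) (f : V -> V -> W) :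
  (forall y, linear (f^~ y)) -> (forall x, linear (f x)) ->
  exists w : mlin V W 2, forall x y, w x y = f x y.
Proof.
move=> fl fr; exists (linfun (fun x => linfun (f x))) => x y.
rewrite !linfunE // => a u v; apply/lfunP => z.
by rewrite add_lfunE scale_lfunE !linfunE // fl.
Qed.

Lemma cocycle2P (K : numFieldType) (g : lieAlgType K) (w : mlin g g 2) :
  (w \in cocycle g 2) <->
  (forall x y, w x y = - w y x) /\
  (forall x y z, [lie x, w y z] - [lie y, w x z] + [lie z, w x y]
     - w [lie x, y] z + w [lie x, z] y - w [lie y, z] x = 0).
Proof.
have zE x y z : mapply (0 : mlin g g 3) [:: x; y; z] = 0 by rewrite /= !lfunE.
split=> [|[wC wJ]]; rewrite memv_cap memv_ker.
  case/andP=> /cochain2 wC /eqP dw; split=> // x y z.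
  by rewrite -ce_d2E dw zE.
apply/andP; split; first exact/cochain2.
by apply/eqP/mlin_ext => -[|x [|y [|z []]]] // _; rewrite ce_d2E wJ zE.
Qed.

Lemma coboundary2P (K : numFieldType) (g : lieAlgType K) (w : mlin g g 2) :
  (w \in coboundary g 2) <->
  exists f : mlin g g 1, forall x y,
    w x y = [lie x, f y] - [lie y, f x] - f [lie x, y].
Proof.
split=> [/memv_imgP[f _ ->]|[f fE]].
  by exists f => x y; have := ce_d1E f x y.
apply/memv_imgP; exists f; first exact: cochain1.
by apply: mlin_ext => -[|x [|y []]] // _; rewrite ce_d1E /= fE.
Qed.

(** * A nontrivial 2-class on [W_8] *)

Section WittCocycle.
Variable K : numFieldType.
Implicit Types x y z : witt K 8.

(* Normalize a weight-0 cocycle to vanish on [(e_1, e_j)] and [(e_2, e_3)]; the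
   cocycle condition on [(e_1, e_2, e_3)] makes it vanish on [(e_2, e_4)], and
   the one on [(e_1, e_2, e_4)] gives the ratio [-3]. *)
Definition witt8_form x y : K :=
  witt_coef x 2 * witt_coef y 5 - witt_coef x 5 * witt_coef y 2
  - 3 * (witt_coef x 3 * witt_coef y 4 - witt_coef x 4 * witt_coef y 3).

(** As [e_7] has top degree, truncation kills [[e_i, e_7]] for [i > 0]: it spans an ideal on which
    only [e_0] acts. *)
Lemma lie_witt8_vec7 x :
  [lie x, witt_vec K 8 7] = (7 * witt_coef x 0) *: witt_vec K 8 7.
Proof.
apply: (eq_witt_linear (D := fun x => [lie x, _])
  (E := fun x => (7 * witt_coef x 0) *: _)); first exact: lie_linearl.
  by move=> a u v; rewrite witt_coefD witt_coefZ mulrDr scalerDl scalerA mulrCA.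
case=> [|i] id; first by rewrite lie_witt_vec // witt_coef_vec // subr0 mulr1.
rewrite witt_coef_vec // mulr0 scale0r; apply: witt_coef_eq => k kd.
rewrite witt_coef_lie // big1 => [|j _].
  by rewrite /witt_coef linear0 coef0.
have jk : (j <= k)%N by rewrite -ltnS.
rewrite !witt_coef_vec ?(leq_ltn_trans jk) ?(leq_ltn_trans (leq_subr _ _)) //.
case: eqP => [ji|_]; last by rewrite mul0r mulr0.
rewrite (ltn_eqF (leq_trans _ (kd : k <= 7)%N)) ?mulr0 //.
by rewrite ltn_subrL ji /= (leq_trans _ jk) // ji.
Qed.

(** The cocycle identity for [witt8_form] times [e_7], read on the line of [e_7], where [x] acts by
    [7 * witt_coef x 0]. *)
Lemma witt8_form_closed x y z :
  7 * witt_coef x 0 * witt8_form y z - 7 * witt_coef y 0 * witt8_form x z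
  + 7 * witt_coef z 0 * witt8_form x y - witt8_form [lie x, y] z
  + witt8_form [lie x, z] y - witt8_form [lie y, z] x = 0.
Proof.
rewrite /witt8_form !witt_coef_lie // !big_ord_recl !big_ord0 /= /bump /=.
rewrite !(subn0, subnn, subSS).
by ring.
Qed.

Lemma witt8_H2 : exists2 w : mlin (witt K 8) (witt K 8) 2,
  w \in cocycle (witt K 8) 2 & w \notin coboundary (witt K 8) 2.
Proof.
have [] := @bilinear_mlin K _ _ (fun x y => witt8_form x y *: witt_vec K 8 7).
- move=> y a u v; rewrite scalerA -scalerDl; congr (_ *: _).
  by rewrite /witt8_form !witt_coefD !witt_coefZ; ring.
- move=> x a u v; rewrite scalerA -scalerDl; congr (_ *: _).
  by rewrite /witt8_form !witt_coefD !witt_coefZ; ring.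
move=> w wE; exists w.
  apply/cocycle2P; split=> [x y|x y z]; rewrite !wE.
    by rewrite -scaleNr /witt8_form; congr (_ *: _); ring.
  rewrite !lieZr !lie_witt8_vec7 !scalerA -!(scalerBl, scalerDl).
  rewrite -[RHS](scale0r (witt_vec K 8 7)).
  by congr (_ *: _); rewrite -(witt8_form_closed x y z); ring.
apply/negP => /coboundary2P[f fE].
pose p i := witt_coef (f (witt_vec K 8 i)) i.
(* Coefficient of [e_(i+j)] in the coboundary equation at [(e_i, e_j)]; it sees only the diagonal of
   [f]. *)
have pE i j : (i + j < 8)%N -> witt8_form (witt_vec K 8 i) (witt_vec K 8 j)
    * (i + j == 7)%:R = (j%:R - i%:R) * (p i + p j - p (i + j)%N).
  move=> ij; 
  have := congr1 (fun v => witt_coef v (i + j)%N)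
    (fE (witt_vec K 8 i) (witt_vec K 8 j)).
  rewrite /= wE witt_coefZ witt_coef_vec // => ->.
  rewrite -!scaleN1r !witt_coefD !witt_coefZ lie_witt_vec // linearZ witt_coefZ.
  rewrite !witt_coef_lie_vec ?leq_addr ?leq_addl //.
  rewrite addKn addnK -/(p _) -/(p _) -/(p _).
  by ring.
have pD i j : (i < j)%N -> (i + j < 8)%N ->
    witt8_form (witt_vec K 8 i) (witt_vec K 8 j) = 0 -> p (i + j)%N = p i + p j.
  move=> ij ij8 ij0; have := pE _ _ ij8; rewrite ij0 mul0r => /esym/eqP.
  rewrite mulf_eq0 subr_eq0 eqr_nat gtn_eqF //= subr_eq0 => /eqP //.
have pi : forall i, (0 < i < 8)%N -> p i = i%:R * p 1%N.
  apply: weights_proportional => // [j j1 j8|].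
    by apply: (pD 1%N) => //; rewrite /witt8_form !witt_coef_vec //=; ring.
  by apply: (pD 2 3) => //; rewrite /witt8_form !witt_coef_vec //=; ring.
(* The contradiction: the form is 1 on [(e_2, e_5)], while the right side is
   [3 * (2 + 5 - 7) * p 1 = 0]. *)
have /eqP := pE 2 5 isT; rewrite /witt8_form !witt_coef_vec //=.
rewrite (pi 2) // (pi 5) // (pi 7) //.
rewrite -subr_eq0 [X in X == 0](_ : _ = 1) ?oner_eq0 //.
by ring.
Qed.
End WittCocycle.

(** * Direct powers: completeness and second cohomology *)

Lemma lie0l (K : numFieldType) (g : lieAlgType K) (x : g) : [lie 0, x] = 0.
Proof. by rewrite lieC lie0r oppr0. Qed.

Definition lie_power (K : numFieldType) (g : lieAlgType K) (n : nat) : Type :=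
  {ffun 'I_n -> g}.

Section Power.
Variables (K : numFieldType) (g : lieAlgType K) (n : nat).

HB.instance Definition _ := Vector.copy (lie_power g n) {ffun 'I_n -> g}.

Implicit Types x y z : lie_power g n.

Definition power_bracket x y : lie_power g n := [ffun i => [lie x i, y i]].

Lemma power_linearl y : linear (power_bracket^~ y).
Proof. by move=> a x z; apply/ffunP => i; rewrite !ffunE lieDl lieZl. Qed.

Lemma power_linearr x : linear (power_bracket x).
Proof. by move=> a y z; apply/ffunP => i; rewrite !ffunE lieDr lieZr. Qed.

Lemma power_alt x : power_bracket x x = 0.
Proof. by apply/ffunP => i; rewrite !ffunE lie_alt. Qed.

Lemma power_jacobi x y z :
  power_bracket x (power_bracket y z) + power_bracket y (power_bracket z x)
    + power_bracket z (power_bracket x y) = 0.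
Proof. by apply/ffunP => i; rewrite !ffunE lie_jacobi. Qed.

HB.instance Definition _ :=
  isLieAlgebra.Build K (lie_power g n)
    power_linearl power_linearr power_alt power_jacobi.

Lemma power_lieE x y i : [lie x, y] i = [lie x i, y i].
Proof. exact: ffunE. Qed.

Lemma power_addE x y i : (x + y) i = x i + y i.
Proof. exact: ffunE. Qed.

Lemma power_scaleE a x i : (a *: x) i = a *: x i.
Proof. exact: ffunE. Qed.

Lemma power_zeroE i : (0 : lie_power g n) i = 0.
Proof. exact: ffunE. Qed.

Lemma power_oppE x i : (- x) i = - x i.
Proof. exact: ffunE. Qed.

Definition powerE :=
  (power_lieE, power_addE, power_scaleE, power_zeroE, power_oppE).

Definition power_inj i (v : g) : lie_power g n :=
  [ffun j => if j == i then v else 0].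

Lemma power_injE i v : power_inj i v i = v.
Proof. by rewrite ffunE eqxx. Qed.

Lemma power_inj_neq i j v : j != i -> power_inj i v j = 0.
Proof. by rewrite ffunE => /negbTE->. Qed.

Lemma power_inj_linear i : linear (power_inj i).
Proof.
move=> a u v; apply/ffunP => j; rewrite !(powerE, ffunE).
by case: eqP; rewrite ?scaler0 ?addr0.
Qed.

Lemma power_inj_lie i u v :
  power_inj i [lie u, v] = [lie power_inj i u, power_inj i v].
Proof.
by apply/ffunP => j; rewrite !(powerE, ffunE); case: eqP; rewrite ?lie0r.
Qed.

Lemma power_complete : lie_complete g -> lie_complete (lie_power g n).
Proof.
case/lie_completeP=> gZ gD; apply/lie_completeP; split=> [z zc|D lD dD].
  apply/ffunP => i; rewrite [RHS]power_zeroE; apply: gZ => v.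
  by rewrite -[v](power_injE i) -power_lieE zc power_zeroE.
(* If [x i = 0], then [x] commutes with the [i]-th factor, so component [i] of [D x] is central in
   [g], hence 0. Thus [D] acts factor by factor. *)
have D0 x i : x i = 0 -> D x i = 0.
  move=> x0; apply: gZ => v.
  have := congr1 (fun y => y i) (dD x (power_inj i v)).
  have -> : [lie x, power_inj i v] = 0.
    apply/ffunP => j; rewrite !(powerE, ffunE).
    case: eqP => [->|_]; last exact: lie0r.
    by rewrite x0 lie0l.
  have -> : D 0 = 0.
    by have := lD (-1) 0 0; rewrite scaler0 addr0 scaleN1r addNr.
  rewrite !(powerE, ffunE) x0 lie0l addr0 eqxx lieC => /esym/eqP.
  by rewrite eqr_oppLR oppr0 => /eqP.
have Di x i : D x i = D (power_inj i (x i)) i.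
  have := lD 1 (x - power_inj i (x i)) (power_inj i (x i)).
  rewrite !scale1r subrK => ->; rewrite power_addE D0 ?add0r //.
  by rewrite !(powerE, ffunE) eqxx subrr.
have /fin_all_exists[z zE] i : exists z : g, forall v,
    D (power_inj i v) i = [lie z, v].
  apply: (gD (fun v => D (power_inj i v) i)) => [a u v|u v].
    by rewrite power_inj_linear lD !(powerE, ffunE).
  by rewrite power_inj_lie dD !(powerE, ffunE) eqxx.
exists [ffun i => z i] => x; apply/ffunP => i.
by rewrite Di zE !(powerE, ffunE).
Qed.

Lemma power_cohomology2 (w : mlin g g 2) :
  w \in cocycle g 2 -> w \notin coboundary g 2 ->
  (n <= \dim (cohomology (lie_power g n) 2))%N.
Proof.
move=> /cocycle2P[wC wJ] wB.
have /fin_all_exists[W WE] i :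
    exists W : mlin (lie_power g n) (lie_power g n) 2,
    forall x y, W x y = power_inj i (w (x i) (y i)).
  apply: bilinear_mlin => x a u v.
    by rewrite !(powerE, ffunE) linearP add_lfunE scale_lfunE power_inj_linear.
  by rewrite !(powerE, ffunE) linearP power_inj_linear.
have I0 i : power_inj i 0 = 0.
  by apply/ffunP => j; rewrite !(powerE, ffunE) if_same.
have WZ i : W i \in cocycle (lie_power g n) 2.
  apply/cocycle2P; split=> [x y|x y z]; apply/ffunP => j.
    by rewrite !WE wC !(powerE, ffunE); case: eqP; rewrite ?oppr0.
  rewrite !WE !(powerE, ffunE); case: eqP => [->|_]; first exact: wJ.
  by rewrite !lie0r !(subr0, addr0).
(* If [f] is a primitive of the sum and [c i] is nonzero, then [f] restricted and projected to
   factor [i], divided by [c i], is a primitive of [w]. This gives both the freeness of the [W i]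
   and the trivial intersection of their span with the coboundaries. *)
have sumB c : \sum_i c i *: W i \in coboundary (lie_power g n) 2 ->
    forall i, c i = 0.
  case/coboundary2P=> f fE i; apply/eqP; apply: contraNT wB => ci.
  apply/coboundary2P.
  pose fi v := (c i)^-1 *: f (power_inj i v) i.
  exists (linfun fi) => u v.
  have lfi : linear fi.
    move=> a u' v'; rewrite /fi power_inj_linear linearP !(powerE, ffunE).
    by rewrite scalerDr !scalerA mulrC.
  rewrite !linfunE // /fi !lieZr -!scalerBr power_inj_lie.
  have := congr1 (fun y => y i) (fE (power_inj i u) (power_inj i v)).
  rewrite !powerE !power_injE => <-.
  rewrite !sum_lfunE (bigD1 i) //= big1 ?addr0 => [|j ji].
    by rewrite !scale_lfunE WE powerE !power_injE scalerA mulVf ?scale1r.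
  by rewrite !scale_lfunE WE !(power_inj_neq _ ji) linear0 I0 scaler0.
pose Ws := [tuple W i | i < n].
have WsE c : \sum_(i < n) c i *: Ws`_i = \sum_i c i *: W i.
  by apply: eq_bigr => i _; rewrite -tnth_nth tnth_mktuple.
have dW : \dim <<Ws>> = n.
  suff /eqP : free Ws by rewrite size_tuple.
  by apply/freeP => c; rewrite WsE => c0; apply: sumB; rewrite c0 mem0v.
have WB : (<<Ws>> :&: coboundary (lie_power g n) 2 = 0)%VS.
  apply/eqP; rewrite -subv0; apply/subvP => v; rewrite memv_cap memv0.
  case/andP=> /coord_span->; rewrite WsE => /sumB c0.
  by rewrite big1 // => i _; rewrite c0 scale0r.
have WBZ : (<<Ws>> + coboundary (lie_power g n) 2
            <= cocycle (lie_power g n) 2)%VS.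
  rewrite subv_add coboundary_cocycle // andbT; apply/span_subvP => v.
  by case/mapP=> i _ ->.
have BZ := capv_idPr (coboundary_cocycle (lie_power g n) (leqnn 2)).
(* With [Z] the cocycles and [B] the coboundaries, [n + dim B <= dim Z], and the complement of [B]
   in [Z] has dimension [dim Z - dim B]. *)
have := dimvS WBZ; rewrite dimv_disjoint_sum // dW.
by rewrite -(dimv_cap_compl (cocycle _ 2) (coboundary _ 2)) BZ addnC leq_add2l.
Qed.
End Power.

Theorem corollary3 (R : realType) (n : nat) (n_gt0 : (0 < n)%N) :
  exists r : lieAlgType R[i],
    lie_complete r /\ (n <= \dim (cohomology r 2))%N.
Proof.
have [w wZ wB] := witt8_H2 R[i].
exists (lie_power (witt R[i] 8) n); split.
  by apply: power_complete; apply: witt_complete.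
exact: power_cohomology2 wZ wB.
Qed.
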